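(* Let $\mathcal P_4$ be the family of all 3-uniform minimal 4-paths. For every integer $r$ with $1\le r\le 4$, the $r$-color Ramsey number of $\mathcal P_4$ satisfies $R(\mathcal P_4;r)=r+6$.
   Context: A 3-graph consists of a finite vertex set and a set of 3-element subsets of it (edges). A (3-uniform) minimal 4-path is a 3-graph (without isolated vertices) with edge set $\{a_0,a_1,a_2,a_3\}$ such that $a_i\cap a_j\ne\emptyset$ if and only if $|i-j|\le 1$; $\mathcal P_4$ is the family of all of them. $K_n^{(3)}$ is the complete 3-graph on $n$ vertices. For a family $\mathcal F$ of 3-graphs and a positive integer $r$, $R(\mathcal F;r)$ is the smallest integer $n$ such that every coloring of the edges of $K_n^{(3)}$ with $r$ colors yields a monochromatic copy of a member of $\mathcal F$. *)

(* Defs.v *)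
From mathcomp Require Import all_boot ssrint.
Import IntDist.

Set Implicit Arguments.
Unset Strict Implicit.
Unset Printing Implicit Defensive.

Record graph3 := Graph3 {
  vertex : finType;
  edges : {set {set vertex}};
  edges_card3 : forall e, e \in edges -> #|e| = 3 }.

Definition no_isolated_vertex (G : graph3) : Prop :=
  forall v : vertex G, exists2 e, e \in edges G & v \in e.

(* The intersection condition already forces the four edges to be distinct. *)
Definition minimal_4path (G : graph3) : Prop :=
  no_isolated_vertex G /\
  exists a : 'I_4 -> {set vertex G},
    edges G = [set a i | i : 'I_4] /\
    forall i j : 'I_4, a i :&: a j <> set0 <-> (`|i - j| <= 1)%N.

(* Copies are not required to be induced. *)
Definition contains_copy (F G : graph3) : Prop :=
  exists2 f : vertex F -> vertex G, injective f &
    forall e, e \in edges F -> f @: e \in edges G.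

Definition complete3_edges (n : nat) : {set {set 'I_n}} :=
  [set e : {set 'I_n} | #|e| == 3].

Lemma complete3_card3 (n : nat) (e : {set 'I_n}) :
  e \in complete3_edges n -> #|e| = 3.
Proof. by rewrite inE => /eqP. Qed.

Definition complete3 (n : nat) : graph3 := Graph3 (@complete3_card3 n).

Definition edge_of (G : graph3) : finType := {e : {set vertex G} | e \in edges G}.

Section ColorClass.
Variables (G : graph3) (r : nat) (c : edge_of G -> 'I_r) (i : 'I_r).

Definition color_class_edges : {set {set vertex G}} :=
  [set val e | e : edge_of G & c e == i].

Lemma color_class_card3 (e : {set vertex G}) :
  e \in color_class_edges -> #|e| = 3.
Proof. by case/imsetP => -[e' e'G] _ ->; apply: edges_card3. Qed.

Definition color_class : graph3 := Graph3 color_class_card3.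

End ColorClass.

Definition arrows (Fam : graph3 -> Prop) (r n : nat) : Prop :=
  forall c : edge_of (complete3 n) -> 'I_r,
    exists i : 'I_r, exists2 F, Fam F & contains_copy F (color_class c i).

(* [is_ramsey_number Fam r n] means R(Fam; r) = n. *)
Definition is_ramsey_number (Fam : graph3 -> Prop) (r n : nat) : Prop :=
  arrows Fam r n /\ forall m, arrows Fam r m -> n <= m.

(* Main.v *)
Require Import Defs.
From mathcomp Require Import all_boot ssrint zify.
Import IntDist.

Set Implicit Arguments.
Unset Strict Implicit.
Unset Printing Implicit Defensive.

(* The lower bound colours a triple by its least element, with the last 6 vertices
   forming one further colour class: a star has no two disjoint edges, and a
   minimal 4-path has at least 7 vertices.

   For the upper bound, a P4-free 3-graph with sufficiently many edges is nearly a
   star: on 10 (9, 8, 7) vertices, 30 (27, 25, 24) edges force a vertex that at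
   most 4 (3, 4, 6) edges avoid. Among r colours on r + 6 vertices one is that
   popular; deleting the centre of its star leaves r - 1 colours on r + 5 vertices
   and a few triples that have lost their colour. At r = 0 fewer than 20 triples
   would have lost their colour, but all 20 triples on 6 vertices have.

   The four extremal facts are proved by branch-and-bound trees that a verified
   checker runs through. A branch decides an edge up to the symmetries of the edges
   decided so far; a present edge excludes those that would complete a minimal
   4-path, and a matching of undecided edges that exclude each other bounds the
   number of edges still possible. *)

(** * Edges as bit sequences, and the edges that complete a minimal 4-path *)

Fixpoint meet (e f : bitseq) : bool :=
  match e, f with
  | x :: e', y :: f' => if x && y then true else meet e' f'
  | _, _ => false
  end.

Lemma meetP e f :
  reflect (exists2 i, nth false e i & nth false f i) (meet e f).
Proof.
elim: e f => [|x e IHe] [|y f] /=; try by constructor; case=> -[|i].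
case: ifP => [/andP[xT yT]|xyF]; first by constructor; exists 0.
apply: (iffP (IHe f)) => [[i ei fi]|[[|i] /= ei fi]]; first by exists i.+1.
  by rewrite ei fi in xyF.
by exists i.
Qed.

Lemma meetC e f : meet e f = meet f e.
Proof. by apply/meetP/meetP => -[i ei fi]; exists i. Qed.

Definition p4 (a b c d : bitseq) : bool :=
  [&& meet a b, meet b c, meet c d, ~~ meet a c, ~~ meet a d & ~~ meet b d].

Definition p4free (G : pred bitseq) : Prop :=
  forall a b c d, G a -> G b -> G c -> G d -> ~~ p4 a b c d.

(* [(a, b, c, s)] stands for the edges that meet exactly one of [a] and [b],
   and meet [c] if and only if [s] holds. *)
Definition pattern : Type := bitseq * bitseq * bitseq * bool.

Definition hits (y : bitseq) (q : pattern) : bool :=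
  let: (a, b, c, s) := q in
  if meet y a (+) meet y b then meet y c == s else false.

(* A minimal 4-path minus an end edge is a path of length 3, and minus an inner
   edge it is an intersecting pair together with an edge disjoint from both;
   the pattern describes the edges that complete [x], [u], [w]. *)
Definition pattern_of (x u w : bitseq) : option pattern :=
  match meet u w, meet u x, meet w x with
  | true, true, false => Some (w, x, u, false)
  | true, false, true => Some (u, x, w, false)
  | false, true, true => Some (u, w, x, false)
  | true, false, false => Some (u, w, x, true)
  | false, true, false => Some (u, x, w, true)
  | false, false, true => Some (w, x, u, true)
  | _, _, _ => None
  end.

Lemma pattern_of_p4free (G : pred bitseq) x u w y q :
  p4free G -> G x -> G u -> G w -> G y ->
  pattern_of x u w = Some q -> hits y q = false.
Proof.
move=> free Gx Gu Gw Gy.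
have F := fun a b c d Ga Gb Gc Gd => negP (free a b c d Ga Gb Gc Gd).
(* [p4] depends only on which pairs meet, so it is enough to list the twelve orders of the four
   edges up to reversal: [y] is an end edge in the first six and an inner edge in the last six. *)
move: (F x u w y Gx Gu Gw Gy) (F u x w y Gu Gx Gw Gy) (F x w u y Gx Gw Gu Gy).
move: (F y x u w Gy Gx Gu Gw) (F y u x w Gy Gu Gx Gw) (F y x w u Gy Gx Gw Gu).
move: (F x u y w Gx Gu Gy Gw) (F u x y w Gu Gx Gy Gw) (F x w y u Gx Gw Gy Gu).
move: (F w x y u Gw Gx Gy Gu) (F u w y x Gu Gw Gy Gx) (F w u y x Gw Gu Gy Gx).
rewrite /p4 /pattern_of (meetC u x) (meetC x w) (meetC w u).
rewrite (meetC x y) (meetC u y) (meetC w y).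
case: (meet u w); case: (meet x u); case: (meet w x) => /=;
  case Ex: (meet y x); case Eu: (meet y u); case Ew: (meet y w) => //=;
  by move=> *; try (exfalso; auto; fail);
     match goal with H : Some _ = Some _ |- _ => case: H => <- end;
     rewrite /hits /= ?Ex ?Eu ?Ew.
Qed.

Fixpoint patterns (x : bitseq) (inn : seq bitseq) : seq pattern :=
  if inn is u :: r then pmap (pattern_of x u) r ++ patterns x r else [::].

(** This fact serves twice: it deletes edges in the branch where [x] is present, and it supplies the
    excluded pairs of the matching. *)
Lemma patterns_p4free (G : pred bitseq) x y inn :
  p4free G -> all G inn -> G x -> G y -> ~~ has (hits y) (patterns x inn).
Proof.
move=> free + Gx Gy; elim: inn => //= u r IHr /andP[Gu Gr].
rewrite has_cat negb_or IHr // andbT; apply/hasPn => q.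
rewrite mem_pmap => /mapP[w /(allP Gr) Gw /esym eq_q].
by rewrite (pattern_of_p4free free Gx Gu Gw Gy eq_q).
Qed.

(** * The matching bound on the number of further edges *)

Fixpoint take_conflict (z : bitseq) (o : seq (bitseq * seq pattern)) :=
  if o is yq :: r then
    if has (hits z) yq.2 then Some r
    else if take_conflict z r is Some r' then Some (yq :: r') else None
  else None.

(* The size of a cover of [und] by pairs of edges that are not both present
   beside [inn], and by single edges; [o] holds the single edges so far. *)
Fixpoint cover (inn : seq bitseq) (o : seq (bitseq * seq pattern))
    (und : seq bitseq) : nat :=
  if und is z :: r then
    if take_conflict z o is Some o' then cover inn o' r
    else (cover inn ((z, patterns z inn) :: o) r).+1
  else 0.

Section Cover.
Variables (G : pred bitseq) (inn : seq bitseq).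
Hypotheses (free : p4free G) (Ginn : all G inn).

Let tag y := (y, patterns y inn).

(** The edge taken out of the list and [z] exclude each other, so together they contribute at most
    one present edge. *)
Lemma take_conflict_count z ys o :
  take_conflict z [seq tag y | y <- ys] = Some o ->
  exists ys', [/\ o = [seq tag y | y <- ys'], size ys = (size ys').+1
    & G z + count G ys <= (count G ys').+1].
Proof.
elim: ys o => //= y ys IHys o; case: ifP => [zy [<-]|_].
  exists ys; split=> //; have: ~~ (G y && G z).
    by apply: contraL zy => /andP[Gy Gz]; apply: (patterns_p4free free Ginn).
  by case: (G y); case: (G z) => //=; lia.
case E: take_conflict => [o'|] // [<-].
have [ys' [-> -> le_ys']] := IHys _ E.
by exists (y :: ys'); split=> //=; lia.
Qed.

(** Induction over [und], generalised to the single edges [ys]. Each of them has already been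
    charged one, so an edge matched with it later is free; an edge that finds no partner becomes
    single and is charged one. *)
Lemma count_cover_tag und ys :
  count G und + count G ys <= size ys + cover inn [seq tag y | y <- ys] und.
Proof.
elim: und ys => [|z r IHr] ys /=; first by rewrite add0n addn0 count_size.
case E: take_conflict => [o|].
  have [ys' [-> -> le_ys']] := take_conflict_count E.
  by have := IHr ys'; lia.
by move: (IHr (z :: ys)); rewrite /tag /=; lia.
Qed.

Lemma count_cover und : count G und <= cover inn [::] und.
Proof. by have := count_cover_tag und [::]; rewrite addn0. Qed.

End Cover.

(** * The list of all edges, and vertex permutations acting on it *)

Fixpoint triples (n k : nat) : seq bitseq :=
  match n, k with
  | 0, 0 => [:: [::]]
  | 0, _ => [::]
  | n'.+1, 0 => [seq false :: e | e <- triples n' 0]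
  | n'.+1, k'.+1 =>
    [seq true :: e | e <- triples n' k'] ++ [seq false :: e | e <- triples n' k]
  end.

Lemma mem_triples n k e :
  (e \in triples n k) = (size e == n) && (count id e == k).
Proof.
have mem_cons (b b' : bool) (s : bitseq) (S : seq bitseq) :
    (b :: s \in [seq b' :: f | f <- S]) = (b == b') && (s \in S).
  apply/mapP/andP => [[f Sf [-> ->]]|[/eqP-> Ss]]; first by rewrite eqxx.
  by exists s.
have nil_cons (b : bool) (S : seq bitseq) : [::] \in [seq b :: f | f <- S] = false.
  by apply/mapP => -[].
elim: n k e => [|n IHn] [|k] [|b e] //=; rewrite ?mem_cat ?mem_cons ?nil_cons //.
- by rewrite IHn; case: b; rewrite //= andbF.
- by rewrite !IHn; case: b; rewrite /= ?orbF.
Qed.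

Lemma uniq_triples n k : uniq (triples n k).
Proof.
elim: n k => [|n IHn] [|k] //=; first by rewrite map_inj_uniq // => e f [].
rewrite cat_uniq !map_inj_uniq ?IHn ?andbT /=; try by move=> e f [].
by apply/hasPn => _ /mapP[e _ ->]; apply/mapP => -[].
Qed.

(** Bit [i] of the image is bit [nth 0 p i] of [e]; a vertex [v] thus moves to position
    [index v p]. *)
Definition act (p : seq nat) (e : bitseq) : bitseq := [seq nth false e i | i <- p].

Section Act.
Variables (n : nat) (p : seq nat).
Hypothesis p_perm : perm_eq p (iota 0 n).

Let size_p : size p = n. Proof. by rewrite (perm_size p_perm) size_iota. Qed.

Let mem_p i : (i \in p) = (i < n).
Proof. by rewrite (perm_mem p_perm) mem_iota. Qed.

Lemma nth_act e i : size e = n -> nth false (act p e) (index i p) = nth false e i.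
Proof.
move=> size_e; case: (boolP (i \in p)) => [ip|inp].
  by rewrite (nth_map 0) ?index_mem // nth_index.
(* Outside the vertex set both sides are the default [false]. *)
have le_i: n <= i by rewrite leqNgt -mem_p.
rewrite (memNindex inp) size_p (nth_default _ (_ : size e <= i)) ?size_e //.
by apply: nth_default; rewrite size_map size_p.
Qed.

Lemma act_inj : {in [pred e : bitseq | size e == n] &, injective (act p)}.
Proof.
move=> e f /eqP size_e /eqP size_f eq_ef.
apply: (@eq_from_nth _ false) => [|i _]; first by rewrite size_e.
by rewrite -(nth_act i size_e) eq_ef nth_act.
Qed.

Lemma meet_act e f :
  size e = n -> size f = n -> meet (act p e) (act p f) = meet e f.
Proof.
move=> size_e size_f; apply/meetP/meetP => -[i ei fi]; last first.
  by exists (index i p); rewrite nth_act.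
have lt_ip: i < size p.
  rewrite -(size_map (nth false e)) ltnNge; apply/negP => le_i.
  by rewrite (nth_default _ le_i) in ei.
by exists (nth 0 p i); [move: ei | move: fi]; rewrite (nth_map 0).
Qed.

Lemma act_triples k e : e \in triples n k -> act p e \in triples n k.
Proof.
rewrite !mem_triples size_map size_p eqxx => /andP[/eqP size_e /eqP <-] /=.
rewrite count_map (permP p_perm) -[X in _ == count _ X](mkseq_nth false e).
by rewrite /mkseq size_e count_map.
Qed.

(** An injection of a finite set into itself is onto. Counts over all edges are therefore invariant
    under relabelling. *)
Lemma perm_act_triples k : perm_eq [seq act p e | e <- triples n k] (triples n k).
Proof.
have inj: {in triples n k &, injective (act p)}.
  by move=> e f; rewrite !mem_triples => /andP[? _] /andP[? _]; apply: act_inj.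
have uniq_act: uniq [seq act p e | e <- triples n k].
  by rewrite map_inj_in_uniq ?uniq_triples.
apply: uniq_perm => //; first exact: uniq_triples.
apply: (uniq_min_size uniq_act _ _).2; last by rewrite size_map.
by move=> _ /mapP[e Ee ->]; apply: act_triples.
Qed.

End Act.

(** * Certificates and the soundness of their checker *)

Definition orbit_of (gens : seq (seq nat)) (d : nat) (x : bitseq) : seq bitseq :=
  iter d (fun s => undup (s ++ flatten [seq [seq act p e | e <- s] | p <- gens]))
    [:: x].

(* [Split i gens d c1 c2] branches on the [i]-th undecided edge [x]: either [x]
   is present ([c1]), or the images of [x] under the words of length at most [d]
   in the symmetries [gens] are all absent ([c2]). *)
Inductive cert :=
  | Leaf
  | Centre of nat
  | Split of nat & seq (seq nat) & nat & cert & cert.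

Definition avoiding (v : nat) (e : bitseq) : bool := ~~ nth false e v.

Section Check.
Variables n t k : nat.

(* The edges of [inn] are present, and those outside [inn ++ und] absent. *)
Fixpoint check (inn und : seq bitseq) (c : cert) : bool :=
  match c with
  | Leaf => size inn + cover inn [::] und < t
  | Centre v => (v < n) && (count (avoiding v) (inn ++ und) <= k)
  | Split i gens d c1 c2 =>
    let x := nth [::] und i in
    let o := orbit_of gens d x in
    [&& i < size und, all (fun p => [&& perm_eq p (iota 0 n), all (fun e => act p e \in inn) inn
                        & all (fun e => act p e \in und) und]) gens,
        (let q := patterns x inn in
         check (x :: inn) [seq y <- und | ~~ ((y == x) || has (hits y) q)] c1) &
        check inn [seq y <- und | y \notin o] c2]
  end.

Let E := triples n 3.

(** The negation of the extremal claim, which treats all vertices alike, so that vertex permutations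
    preserve it. *)
Definition counterexample (G : pred bitseq) : Prop :=
  [/\ {subset G <= E}, p4free G, t <= count G E
    & forall v, v < n -> k < count (predI G (avoiding v)) E].

Definition between (inn und : seq bitseq) (G : pred bitseq) : Prop :=
  all G inn /\ {subset G <= inn ++ und}.

(** Relabelling preserves meeting and counts. The pulled-back family is cut down to [E] because
    [act p] may turn a bit sequence of another length into an edge. *)
Lemma counterexample_act p G :
  perm_eq p (iota 0 n) -> counterexample G ->
  counterexample [pred e in E | G (act p e)].
Proof.
move=> p_perm [GE free le_t lt_k].
have size_E e : e \in E -> size e = n by rewrite mem_triples => /andP[/eqP].
have count_act (P : pred bitseq) : count P E = count (fun e => P (act p e)) E.
  by rewrite -(permP (perm_act_triples p_perm 3)) count_map.
have restrict (P : pred bitseq) : count (predI (mem E) P) E = count P E.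
  by apply: eq_in_count => e /= ->.
split=> [e /andP[] // | a b c d | | v lt_vn].
- move=> /andP[/size_E sa Ga] /andP[/size_E sb Gb] /andP[/size_E sc Gc].
  move=> /andP[/size_E sd Gd]; have := free _ _ _ _ Ga Gb Gc Gd.
  by rewrite /p4 !(meet_act p_perm).
- by rewrite restrict -(count_act G).
(* An edge avoids [v] exactly when its image avoids [index v p]. *)
- have := lt_k (index v p) _; rewrite -{1}(size_iota 0 n) -(perm_size p_perm).
  rewrite index_mem (perm_mem p_perm) mem_iota lt_vn => /(_ isT).
  rewrite count_act; congr (_ < _); apply: eq_in_count => e /= Ee.
  by rewrite /avoiding (nth_act p_perm) ?size_E //; move: Ee => /= ->.
Qed.

(** The checker tests only that [p] maps [inn] and [und] into themselves. Being injective on the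
    finite set [inn ++ und], [act p] is then onto it, so an edge whose image lies there lies there
    itself. *)
Lemma between_act p (inn und : seq bitseq) G :
  perm_eq p (iota 0 n) -> {subset inn ++ und <= E} ->
  all (fun e => act p e \in inn) inn -> all (fun e => act p e \in und) und ->
  between inn und G -> between inn und [pred e in E | G (act p e)].
Proof.
move=> p_perm sE /allP pinn /allP pund [/allP Ginn Gsub]; split.
  by apply/allP => e ie /=; rewrite sE ?mem_cat ?ie // Ginn // pinn.
move=> e /andP[/= Ee /Gsub]; set s := inn ++ und => in_s.
have inj: {in E &, injective (act p)}.
  move=> f g; rewrite !mem_triples => /andP[? _] /andP[? _].
  exact: (act_inj p_perm).
(* The counting argument needs a list without repetitions, which [inn ++ und] is not known to be. *)
have uniq_act: uniq [seq act p f | f <- undup s].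
  rewrite map_inj_in_uniq ?undup_uniq // => f g.
  by rewrite !mem_undup => /sE ? /sE ?; apply: inj.
have sub_act: {subset [seq act p f | f <- undup s] <= undup s}.
  move=> _ /mapP[f + ->]; rewrite !mem_undup !mem_cat.
  by case/orP => [/pinn ->|/pund ->]; rewrite ?orbT.
have [|_ eq_act] := uniq_min_size uniq_act sub_act; first by rewrite size_map.
move: in_s; rewrite -mem_undup -eq_act => /mapP[f]; rewrite mem_undup => sf.
by move/inj => -> //; apply: sE.
Qed.

(** A counterexample containing [act p e] pulls back along [p] to one within the same bounds that
    contains [e]; hence absence is assumed for all counterexamples at once. Every depth [d] is
    sound, as a smaller one only lists fewer absent edges. *)
Lemma orbit_absent gens d x y (inn und : seq bitseq) :
  {subset inn ++ und <= E} -> x \in E ->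
  all (fun p => [&& perm_eq p (iota 0 n), all (fun e => act p e \in inn) inn
                  & all (fun e => act p e \in und) und]) gens ->
  (forall G, counterexample G -> between inn und G -> ~~ G x) ->
  y \in orbit_of gens d x ->
  y \in E /\ forall G, counterexample G -> between inn und G -> ~~ G y.
Proof.
move=> sE Ex /allP gensP absent_x; rewrite /orbit_of.
elim: d y => [|d IHd] y /=; first by rewrite inE => /eqP ->.
rewrite mem_undup mem_cat => /orP[/IHd //|].
case/flattenP => _ /mapP[p gp ->] /mapP[e /IHd[Ee absent_e] ->].
have /and3P[p_perm pinn pund] := gensP p gp.
split=> [|G cG bG]; first exact: act_triples.
have := absent_e _ (counterexample_act p_perm cG).
by move=> /(_ (between_act p_perm sE pinn pund bG)) /=; rewrite Ee.
Qed.

Lemma check_sound c (inn und : seq bitseq) G :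
  {subset inn ++ und <= E} -> check inn und c ->
  counterexample G -> between inn und G -> False.
Proof.
elim: c inn und G => [|v|i gens d c1 IH1 c2 IH2] inn und G sE /=.
- move=> lt_t [GE free le_t _] [Ginn Gsub].
  (* All edges of [G] lie in [inn ++ und], and [cover] bounds those in [und], which leaves fewer
     than [t]. *)
  have le_count: count G E <= count G (inn ++ und).
    rewrite -!size_filter uniq_leq_size ?filter_uniq ?uniq_triples // => e.
    by rewrite !mem_filter => /andP[Ge _]; rewrite Ge Gsub.
  have := count_cover free Ginn und; move: le_count.
  by rewrite count_cat; have := count_size G inn; lia.
- move=> /andP[lt_vn le_k] [GE _ _ /(_ v lt_vn)] lt_k [_ Gsub].
  (* Even if all undecided edges were present, too few edges would avoid [v]. *)
  suff: count (predI G (avoiding v)) E <= count (avoiding v) (inn ++ und) by lia.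
  rewrite -!size_filter uniq_leq_size ?filter_uniq ?uniq_triples // => e.
  by rewrite !mem_filter => /andP[/andP[Ge ->] _]; rewrite Gsub.
set x := nth _ _ _ => /and4P[lt_i gensP chk1 chk2] cG bG.
have Ex : x \in E by rewrite sE // mem_cat mem_nth ?orbT.
(* The branch where [x] is present refutes every counterexample containing [x], which is the form
   that [orbit_absent] asks for. *)
have absent_x H : counterexample H -> between inn und H -> ~~ H x.
  move=> cH [Hinn Hsub]; apply/negP => Hx.
  have [_ free _ _] := cH.
  apply: (IH1 _ _ _ _ chk1 cH) => [e|].
    rewrite inE mem_cat mem_filter => /or3P[/eqP -> | ie | /andP[_ ue]].
    - by [].
    - by rewrite sE // mem_cat ie.
    - by rewrite sE // mem_cat ue orbT.
  split=> /= [|e He]; first by rewrite Hx.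
  rewrite inE mem_cat mem_filter; have := Hsub e He; rewrite mem_cat.
  case/orP => [->|->]; rewrite ?orbT //= andbT negb_or.
  (* No edge of [H] is lost in this branch: one that hits a pattern of [x] would exclude [x]. *)
  by rewrite (patterns_p4free free Hinn Hx He) andbT; case: eqP; rewrite ?orbT.
apply: (IH2 _ _ _ _ chk2 cG) => [e|].
  rewrite mem_cat mem_filter => /orP[ie|/andP[_ ue]]; apply: sE.
    by rewrite mem_cat ie.
  by rewrite mem_cat ue orbT.
case: (bG) => Ginn Gsub; split=> // e Ge.
rewrite mem_cat mem_filter; have := Gsub e Ge; rewrite mem_cat.
case/orP => [->|->] //; rewrite andbT orbC.
case: (boolP (e \in _)) => //= oe.
have [_ absent_e] := orbit_absent sE Ex gensP absent_x oe.
by case/negP: (absent_e G cG bG).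
Qed.

Lemma check_turan c (G : pred bitseq) :
  check [::] E c -> {subset G <= E} -> p4free G -> t <= count G E ->
  exists2 v, v < n & count (predI G (avoiding v)) E <= k.
Proof.
move=> chk GE free le_t.
case: (boolP (has (fun v => count (predI G (avoiding v)) E <= k) (iota 0 n))).
  by case/hasP => v; rewrite mem_iota => lt_vn le_k; exists v.
move=> /hasPn no_v; exfalso; apply: (check_sound (G := G) _ chk) => //.
split=> // v lt_vn; rewrite ltnNge no_v // mem_iota //.
Qed.

End Check.

(** A stability statement: with the values proved below, a dense family without minimal 4-paths is a
    star up to [k] edges. *)
Definition turan (n t k : nat) : Prop :=
  forall G : pred bitseq, {subset G <= triples n 3} -> p4free G ->
    t <= count G (triples n 3) ->
  exists2 v, v < n & count (predI G (avoiding v)) (triples n 3) <= k.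

Lemma turan_of_check n t k c : check n t k [::] (triples n 3) c -> turan n t k.
Proof. by move=> chk G; apply: check_turan chk. Qed.

(** * Deleting a vertex, and the induction on the number of colours *)

Definition insert (v : nat) (e : bitseq) : bitseq := take v e ++ false :: drop v e.

Lemma size_insert v e : size (insert v e) = (size e).+1.
Proof. by rewrite size_cat /= addnS -size_cat cat_take_drop. Qed.

Lemma meet_insert v e f : meet (insert v e) (insert v f) = meet e f.
Proof.
elim: v e f => [|v IHv] [|x e] [|y f] //; rewrite /insert /= ?andbF //.
- by case: (take v e ++ _).
- by rewrite -/(insert v e) -/(insert v f) IHv.
Qed.

Lemma insert_inj v : injective (insert v).
Proof.
move=> e f eq_ef; have eq_size: size e = size f.
  by apply/succn_inj; rewrite -!(size_insert v) eq_ef.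
move/eqP: eq_ef; rewrite eqseq_cat ?size_take ?eq_size //.
case/andP => /eqP eq_take /eqP[eq_drop].
by rewrite -(cat_take_drop v e) eq_take eq_drop cat_take_drop.
Qed.

Lemma insert_triples v n k e :
  v <= n -> e \in triples n k ->
  insert v e \in triples n.+1 k /\ avoiding v (insert v e).
Proof.
move=> le_vn; rewrite !mem_triples size_insert eqSS => /andP[/eqP size_e /eqP <-].
rewrite size_e eqxx count_cat /= add0n -count_cat cat_take_drop eqxx /avoiding.
by rewrite nth_cat size_takel ?size_e // ltnn subnn.
Qed.

(** Adding an isolated vertex at position [v] embeds the edges on [n] vertices into those on [n.+1]
    vertices that avoid [v]. *)
Lemma count_insert (P : pred bitseq) v n k :
  v <= n ->
  count (P \o insert v) (triples n k) <= count (predI P (avoiding v)) (triples n.+1 k).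
Proof.
move=> le_vn; rewrite -count_map -!size_filter.
apply: uniq_leq_size => [|e].
  by rewrite filter_uniq // map_inj_uniq ?uniq_triples //; apply: insert_inj.
rewrite !mem_filter => /andP[Pe /mapP[f Ef eq_e]]; move: Pe; rewrite eq_e /= => ->.
by have [-> ->] := insert_triples le_vn Ef.
Qed.

Definition colour_class (n : nat) (col : bitseq -> nat) (i : nat) : pred bitseq :=
  [pred e in triples n 3 | col e == i].

(* Edges with colours outside [cs] count as uncoloured. *)
Definition uncoloured_gt (r n m : nat) : Prop :=
  forall (col : bitseq -> nat) (cs : seq nat), size cs = r ->
    (forall i, i \in cs -> p4free (colour_class n col i)) ->
  m < count (fun e => col e \notin cs) (triples n 3).

(** Induction on the list: dropping a colour from it uncolours at most the edges of that class. *)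
Lemma pigeonhole_class n t (col : bitseq -> nat) (cs : seq nat) :
  (forall i, i \in cs -> count (colour_class n col i) (triples n 3) <= t) ->
  size (triples n 3) <=
    count (fun e => col e \notin cs) (triples n 3) + size cs * t.
Proof.
elim: cs => [|i cs IHcs] le_t; first by rewrite addn0 count_predT.
have le_i := le_t i (mem_head _ _).
have /IHcs: forall j, j \in cs -> count (colour_class n col j) (triples n 3) <= t.
  by move=> j j_cs; apply: le_t; rewrite inE j_cs orbT.
have: count (fun e => col e \notin cs) (triples n 3) <=
    count (fun e => col e \notin i :: cs) (triples n 3)
    + count (colour_class n col i) (triples n 3).
  rewrite -count_predUI (leq_trans _ (leq_addr _ _)) //.
  rewrite -!size_filter uniq_leq_size ?filter_uniq ?uniq_triples // => e.
  rewrite !mem_filter /= inE => /andP[e_cs Ee].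
  by rewrite (negbTE e_cs) orbF /colour_class /= Ee !andbT orNb.
by rewrite /= mulSn; lia.
Qed.

(** Suppose at most [m] edges are uncoloured. After deleting the centre of a popular class and
    giving up its colour, an uncoloured edge either was uncoloured before, or belongs to that class
    and avoids its centre. This makes at most [m + k], against the hypothesis on [n] vertices. *)
Lemma uncoloured_gt_step r n m t k :
  turan n.+1 t.+1 k -> m + r.+1 * t < size (triples n.+1 3) ->
  uncoloured_gt r n (m + k) -> uncoloured_gt r.+1 n.+1 m.
Proof.
move=> turan_n lt_m IHr col cs size_cs free; rewrite ltnNge; apply/negP => le_m.
(* If no class has [t.+1] edges, there are at most [m + r.+1 * t] triples in all, which is too
   few. *)
pose popular i := t < count (colour_class n.+1 col i) (triples n.+1 3).
have [|small] := boolP (has popular cs); last first.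
  have /pigeonhole_class : forall i, i \in cs ->
      count (colour_class n.+1 col i) (triples n.+1 3) <= t.
    by move=> i /(hasPn small); rewrite /popular -leqNgt.
  by rewrite size_cs; lia.
case/hasP => i cs_i big.
have [|v lt_vn le_k] := turan_n (colour_class n.+1 col i) _ (free i cs_i) big.
  by move=> e /andP[].
(* [rem] drops a single occurrence of [i], so the list of colours shrinks by exactly one even if it
   has repetitions. *)
have := IHr (col \o insert v) (rem i cs).
rewrite size_rem // size_cs => /(_ erefl) H.
have {}H : m + k < count ((fun e => col e \notin rem i cs) \o insert v) (triples n 3).
  apply: H => j /mem_rem cs_j a b c d.
  move=> /andP[Ea ca] /andP[Eb cb] /andP[Ec cc] /andP[Ed cd].
  have E e := @insert_triples v n 3 e lt_vn.
  have := free j cs_j (insert v a) (insert v b) (insert v c) (insert v d).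
  rewrite /p4 !meet_insert; apply; apply/andP; split=> //.
  - by case: (E a Ea).
  - by case: (E b Eb).
  - by case: (E c Ec).
  - by case: (E d Ed).
have := count_insert (fun e => col e \notin rem i cs) 3 (lt_vn : v <= n).
have: count (predI (fun e => col e \notin rem i cs) (avoiding v)) (triples n.+1 3) <=
    count (fun e => col e \notin cs) (triples n.+1 3)
    + count (predI (colour_class n.+1 col i) (avoiding v)) (triples n.+1 3).
  rewrite -count_predUI (leq_trans _ (leq_addr _ _)) //.
  rewrite -!size_filter uniq_leq_size ?filter_uniq ?uniq_triples // => e.
  rewrite !mem_filter /= => /andP[/andP[e_cs ->] Ee].
  rewrite /colour_class /= Ee !andbT.
  by apply: contraNT e_cs => /norP[/negPn cs_e ?]; rewrite rem_mem.
lia.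
Qed.

(** * The certificates for 7, 8, 9 and 10 vertices *)

Section Trees.

Local Notation L := Leaf.
Local Notation C := Centre.
Local Notation T := Split.
(** A branch without symmetries: in its second subtree only the chosen edge becomes absent. *)
Local Notation B i := (Split i [::] 0).

(** Indices refer to the list of edges still undecided, in the order of [triples]. As in the later
    trees, the root decides the edge on the vertices 0, 1, 2; without its images too few edges
    remain, so the second subtree of the root is a [Leaf]. *)
Definition tree7 : cert :=
(T 0 [::[::0;1;3;2;4;5;6]; [::0;1;3;4;2;5;6]; [::0;1;3;4;5;2;6]; [::0;1;3;4;5;6;2];
[::0;3;1;2;4;5;6]; [::3;0;1;2;4;5;6]] 5 (T 8 [::[::0;1;2;3;5;4;6]; [::0;1;2;3;5;6;4];
[::0;1;2;5;3;4;6]; [::1;0;2;3;4;5;6]; [::1;2;0;3;4;5;6]] 4 (T 22 [::[::0;2;1;3;4;5;6];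
[::0;3;4;1;2;5;6]] 2 (T 8 [::[::0;1;2;3;4;6;5]; [::0;1;2;4;3;5;6]; [::1;0;2;5;6;3;4]] 3 (B 29 (B 9
L L) (B 24 L (B 26 L (B 19 L (B 16 L L))))) L) (T 18 [::[::0;1;2;3;4;6;5]; [::0;1;2;4;3;5;6];
[::0;2;1;3;4;5;6]] 3 (T 7 [::[::0;3;4;1;2;5;6]] 1 (B 22 L L) (B 23 (B 5 L L) (T 6
[::[::0;3;4;1;2;5;6]] 1 (B 17 L (B 14 L L)) (B 20 L L)))) L)) L) L).

Definition tree8 : cert :=
(T 0 [::[::0;1;3;2;4;5;6;7]; [::0;1;3;4;2;5;6;7]; [::0;1;3;4;5;2;6;7]; [::0;1;3;4;5;6;2;7];
[::0;1;3;4;5;6;7;2]; [::0;3;1;2;4;5;6;7]; [::3;0;1;2;4;5;6;7]] 5 (T 10 [::[::0;1;2;3;5;4;6;7];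
[::0;1;2;3;5;6;4;7]; [::0;1;2;3;5;6;7;4]; [::0;1;2;5;3;4;6;7]; [::1;0;2;3;4;5;6;7];
[::1;2;0;3;4;5;6;7]] 4 (T 31 [::[::0;1;2;3;4;5;7;6]; [::0;1;2;3;4;7;5;6]; [::0;2;1;3;4;5;6;7];
[::0;3;4;1;2;5;6;7]] 3 (T 43 [::[::0;1;2;3;4;6;5;7]; [::1;0;2;5;6;3;4;7]] 2 (T 17
[::[::5;1;6;3;4;0;2;7]] 1 L (T 0 [::[::0;1;2;4;3;5;6;7]; [::5;1;6;3;4;0;2;7]] 2 (B 32 L (B 35 L (B
30 L (B 7 L (B 12 L (B 31 L (B 29 L (B 25 L (B 28 L (B 9 L (B 5 L (B 4 L (B 24 L (B 23 (B 7 L L)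
(B 3 (T 11 [::[::0;1;7;3;4;5;6;2]] 1 (B 18 L L) L) L))))))))))))))) L)) (T 43
[::[::0;1;2;3;4;6;5;7]; [::0;1;2;4;3;5;6;7]] 2 (T 13 [::[::1;0;2;5;6;3;4;7]] 1 L (T 31
[::[::1;0;2;5;6;3;4;7]] 1 L L)) (T 10 [::[::0;1;2;3;4;6;5;7]; [::0;1;2;4;3;5;6;7];
[::1;0;2;5;6;3;4;7]] 3 (B 26 L (B 33 L (B 26 L (B 33 L (B 32 L (B 30 L (B 27 L (B 26 L (B 14 L (B
18 L (B 18 L (B 9 L (B 21 (B 18 L (B 17 L L)) (B 6 L (B 21 (B 20 L (B 19 L L)) (B 20 (B 19 L L)
L)))))))))))))))) L))) (T 25 [::[::0;1;2;3;4;6;5;7]; [::0;1;2;3;4;6;7;5]; [::0;1;2;4;3;5;6;7];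
[::0;2;1;3;4;5;6;7]] 3 (T 8 [::[::0;1;2;3;4;5;7;6]; [::0;3;4;1;2;5;6;7]] 2 (B 28 L (B 36 L (B 14
(T 18 [::[::0;3;4;1;2;5;7;6]] 1 L L) (B 33 L (B 26 (B 15 L (B 27 L (B 27 L L))) (B 31 L (B 25 L (B
30 L (B 16 L (B 20 (B 13 L L) (B 22 L (B 18 (B 14 (B 20 L L) L) (B 19 L (B 18 (B 18 L L) (B 13 L
(B 8 (T 18 [::[::0;1;2;3;4;5;7;6]] 1 (B 18 L (B 18 L L)) L) (B 21 (B 20 L L) L))))))))))))))))) (T
31 [::[::0;1;2;3;4;5;7;6]] 1 (B 14 L (B 13 L (T 4 [::[::0;3;4;1;2;5;6;7]] 1 L (B 31 L (T 15
[::[::0;3;4;1;2;5;6;7]] 1 L (T 20 [::[::0;3;4;1;2;5;6;7]] 1 (B 5 L L) L)))))) (B 34 L (T 18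
[::[::0;1;2;3;4;5;7;6]; [::0;3;4;1;2;5;6;7]] 2 (B 13 L (B 13 L (B 11 L (B 27 (B 24 L L) (B 10 L (B
6 (B 19 (B 21 L L) L) (B 7 L (B 23 (B 20 L (B 21 L L)) (B 22 (B 21 L L) L))))))))) (B 14 L (T 12
[::[::0;1;2;3;4;5;7;6]; [::1;0;2;3;5;4;6;7]; [::1;3;5;0;2;4;6;7]] 2 (T 21 [::[::0;3;4;1;2;5;6;7]]
1 L (T 14 [::[::0;3;4;1;2;5;6;7]] 1 L (T 19 [::[::0;3;4;1;2;5;6;7]] 1 L (T 18
[::[::0;3;4;1;2;5;6;7]] 1 L L)))) (T 6 [::[::1;0;2;3;5;4;6;7]; [::1;3;5;0;2;4;6;7]] 1 L L)))))))
(T 2 [::[::0;1;2;3;4;6;5;7]; [::0;1;2;3;4;6;7;5]; [::0;2;1;3;4;5;6;7]; [::0;3;4;1;2;5;6;7]] 3 (T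
21 [::[::0;1;2;3;4;5;7;6]] 1 L (B 21 L (T 18 [::[::0;1;2;4;3;5;6;7]] 1 L L))) L))) (T 0
[::[::0;1;2;4;3;5;6;7]; [::0;1;2;4;5;3;6;7]; [::0;1;2;4;5;6;3;7]; [::0;1;2;4;5;6;7;3];
[::0;2;1;3;4;5;6;7]; [::2;0;1;3;4;5;6;7]] 2 L L)) L).

Definition tree9 : cert :=
(T 0 [::[::0;1;3;2;4;5;6;7;8]; [::0;1;3;4;2;5;6;7;8]; [::0;1;3;4;5;2;6;7;8];
[::0;1;3;4;5;6;2;7;8]; [::0;1;3;4;5;6;7;2;8]; [::0;1;3;4;5;6;7;8;2]; [::0;3;1;2;4;5;6;7;8];
[::3;0;1;2;4;5;6;7;8]] 5 (T 12 [::[::0;1;2;3;5;4;6;7;8]; [::0;1;2;3;5;6;4;7;8];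
[::0;1;2;3;5;6;7;4;8]; [::0;1;2;3;5;6;7;8;4]; [::0;1;2;5;3;4;6;7;8]; [::1;0;2;3;4;5;6;7;8];
[::1;2;0;3;4;5;6;7;8]] 4 (T 41 [::[::0;1;2;3;4;5;7;6;8]; [::0;1;2;3;4;5;7;8;6];
[::0;1;2;3;4;7;5;6;8]; [::0;2;1;3;4;5;6;7;8]; [::0;3;4;1;2;5;6;7;8]] 5 (T 64
[::[::0;1;2;3;4;5;6;8;7]; [::0;1;2;3;4;6;5;7;8]; [::0;1;2;4;3;5;6;7;8]] 3 (T 46
[::[::0;3;4;1;2;5;7;6;8]; [::3;0;4;5;7;1;2;6;8]] 2 L (T 9 [::[::0;3;4;1;2;5;7;6;8];
[::1;0;2;5;6;3;4;7;8]] 4 (B 14 (T 19 [::[::0;3;4;1;2;5;7;6;8]] 1 (B 20 L (C 0)) L) L) (T 19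
[::[::0;3;4;1;2;5;7;6;8]; [::1;0;2;5;6;3;4;7;8]] 4 L (T 7 [::[::0;3;4;1;2;5;7;6;8];
[::5;1;6;3;7;0;2;4;8]; [::1;0;2;5;6;3;4;7;8]] 3 (B 19 L (B 39 L (B 33 L (B 37 L (B 32 L (B 29 L (B
13 L (B 7 L (B 29 L (B 28 L (B 24 L (B 15 L (B 25 (B 19 L L) (B 22 L L)))))))))))))) L)))) (T 61
[::[::0;1;2;3;4;6;5;7;8]; [::1;0;2;5;6;3;4;7;8]] 2 (T 47 [::[::0;1;2;3;4;5;6;8;7]] 1 L (T 40
[::[::0;1;2;3;4;5;6;8;7]; [::0;1;2;4;3;5;6;7;8]] 2 L (T 35 [::[::0;1;2;3;4;5;6;8;7]] 1 (B 16 L (B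
32 L (B 29 L (T 31 [::[::0;1;2;4;3;5;6;7;8]] 1 L (T 21 [::[::0;1;2;3;4;5;7;6;8];
[::0;1;2;4;3;5;6;7;8]] 2 (B 9 L (B 6 L (B 25 L (B 24 L (B 11 L (B 10 L (B 9 L (B 19 L L))))))))
L))))) (B 40 L (T 27 [::[::0;1;2;4;3;5;6;7;8]] 1 (B 32 L (B 34 L (B 28 L (B 31 L (B 13 L (T 25
[::[::0;1;2;3;4;5;6;8;7]] 1 (B 22 L (B 22 L L)) L)))))) (T 39 [::[::0;1;2;4;3;5;6;7;8]] 1 L (B 33
L (T 19 [::[::0;1;2;3;4;5;6;8;7]] 1 (T 32 [::[::0;1;2;4;3;5;6;7;8]] 1 L (B 24 L (T 11
[::[::0;1;2;4;3;5;6;7;8]] 1 (B 22 L (B 9 (B 15 (B 20 L (C 0)) L) L)) L))) L)))))))) (T 49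
[::[::0;1;2;3;4;5;6;8;7]; [::0;1;2;4;3;5;6;7;8]; [::1;0;2;5;6;3;4;7;8]] 3 L (T 12
[::[::0;1;2;3;4;6;5;7;8]; [::0;1;2;4;3;5;6;7;8]; [::1;0;2;5;6;3;4;7;8]] 3 (B 45 L (B 34 (B 34 (T
13 [::[::0;1;2;3;4;5;6;8;7]; [::1;0;2;6;4;5;3;7;8]] 2 L L) L) (B 43 L (B 38 L (B 41 (T 10
[::[::0;1;2;3;4;5;6;8;7]] 1 (B 5 (B 21 L (C 0)) L) L) (T 34 [::[::0;1;2;3;4;5;6;8;7]] 1 (B 32 L (B
15 (B 19 (B 21 L (C 0)) L) L)) (B 33 (T 17 [::[::0;1;2;3;4;5;6;8;7]] 1 L (T 23
[::[::0;1;2;3;4;5;6;8;7]] 1 (B 14 L L) L)) (B 36 (B 23 L (B 30 L (T 20 [::[::0;1;2;3;4;5;6;8;7]] 1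
(B 5 (T 15 [::[::0;3;5;1;8;2;6;7;4]] 1 (B 18 (T 10 [::[::0;3;5;1;8;2;6;7;4]] 1 (B 18 L (C 0)) L)
L) L) L) (T 18 [::[::0;1;2;3;4;5;6;8;7]] 1 L (B 22 L L))))) (B 35 (B 23 L (B 31 L (B 23 L (T 28
[::[::0;1;2;3;4;5;6;8;7]] 1 L (T 20 [::[::0;1;2;3;4;5;6;8;7]] 1 (B 11 (B 21 L (C 0)) L) (T 24
[::[::0;1;2;3;4;5;6;8;7]] 1 (B 22 L L) L)))))) (B 27 L (T 32 [::[::0;1;2;3;4;5;6;8;7]] 1 L (B 24
(C 0) (T 22 [::[::0;1;2;3;4;5;6;8;7]] 1 (B 26 L (B 26 L (B 24 (C 0) (B 26 L (B 18 (C 0) (B 11 (C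
0) L)))))) (B 26 (T 15 [::[::0;1;2;3;4;5;6;8;7]] 1 L L) L)))))))))))))) (T 0
[::[::0;1;2;4;3;5;6;7;8]; [::1;0;2;5;6;3;4;7;8]] 2 (T 40 [::[::0;1;2;3;4;6;5;7;8]] 1 L (T 9
[::[::0;1;2;3;4;5;6;8;7]] 1 L L)) L))))) (T 33 [::[::0;1;2;3;4;6;5;7;8]; [::0;1;2;3;4;6;7;5;8];
[::0;1;2;3;4;6;7;8;5]; [::0;1;2;4;3;5;6;7;8]; [::0;2;1;3;4;5;6;7;8]] 3 (T 9
[::[::0;1;2;3;4;5;7;6;8]; [::0;1;2;3;4;5;7;8;6]; [::0;3;4;1;2;5;6;7;8]] 2 (T 37
[::[::0;1;2;3;4;5;6;8;7]] 1 L (T 17 [::[::0;1;2;3;4;5;6;8;7]] 1 (B 33 L (B 26 L (T 30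
[::[::0;3;4;1;2;5;7;6;8]] 1 L (T 25 [::[::0;3;4;1;2;5;7;6;8]] 1 (B 20 (C 0) L) (T 22
[::[::0;3;4;1;2;5;7;6;8]] 1 (C 0) (B 27 L (B 21 (C 0) (T 10 [::[::0;3;4;1;2;5;7;6;8]] 1 (T 17
[::[::0;1;2;3;4;5;8;7;6]] 1 (B 21 L (B 21 (B 20 L (C 0)) (C 0))) (T 15 [::[::0;1;2;3;4;5;8;7;6]] 1
(B 19 (B 18 L L) L) L)) (T 19 [::[::0;3;4;1;2;5;7;6;8]] 1 (B 22 L L) L))))))))) (B 40 (T 36
[::[::0;1;2;3;4;5;6;8;7]] 1 L (B 35 L (T 36 [::[::0;1;2;3;4;5;6;8;7]] 1 L (T 33
[::[::0;1;2;3;4;5;6;8;7]] 1 (B 5 L (B 17 L (B 14 L (B 3 L (B 5 (B 3 L L) L))))) (T 24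
[::[::0;1;2;3;4;5;6;8;7]] 1 L (T 13 [::[::0;1;2;3;4;5;6;8;7]] 1 L (T 16 [::[::0;1;2;3;4;5;6;8;7]]
1 L L))))))) (T 41 [::[::0;1;2;3;4;5;6;8;7]] 1 L (B 40 L (B 33 (T 21 [::[::0;1;2;3;4;5;6;8;7]] 1 L
L) (T 40 [::[::0;1;2;3;4;5;6;8;7]] 1 L (T 27 [::[::0;1;2;3;4;5;6;8;7]] 1 (B 20 L (B 18 L (B 16 L
(B 17 L (B 15 L (T 14 [::[::1;0;2;3;5;4;7;6;8]] 1 (T 18 [::[::0;1;2;3;8;5;6;7;4]] 1 L (B 13 (B 9
(T 14 [::[::0;1;2;3;8;5;6;7;4]] 1 (B 17 L L) L) L) L)) (T 13 [::[::1;0;2;3;5;4;7;6;8]] 1 L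
L))))))) (B 37 (B 23 L L) (B 32 (T 18 [::[::0;1;2;3;4;5;6;8;7]] 1 L (B 16 L (T 4
[::[::0;1;2;3;4;5;6;8;7]] 1 L (T 26 [::[::0;1;2;3;4;5;6;8;7]] 1 (B 13 L L) L)))) (T 34
[::[::0;1;2;3;4;5;6;8;7]] 1 (B 20 L (B 18 L (B 18 L (B 16 L (B 25 L (B 25 L (B 26 L L))))))) (B 22
(C 0) (B 26 L (T 27 [::[::0;1;2;3;4;5;6;8;7]] 1 L (B 24 (T 13 [::[::0;1;2;3;4;5;6;8;7]] 1 (T 14
[::[::0;1;2;3;7;5;6;4;8]] 1 (B 20 L L) L) L) (T 18 [::[::0;1;2;3;4;5;6;8;7]] 1 (B 23 (C 0) (B 7 (B
9 (B 22 (B 18 (C 0) L) L) L) L)) L)))))))))))))))) (T 23 [::[::0;1;2;3;4;5;7;6;8];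
[::0;1;2;3;4;5;7;8;6]; [::0;3;4;1;2;5;6;7;8]] 2 (T 15 [::[::0;1;2;3;4;5;6;8;7]] 1 L (T 15
[::[::0;1;2;3;4;5;6;8;7]] 1 (B 37 L (B 11 L L)) (B 38 L (T 35 [::[::0;1;2;3;4;5;6;8;7]] 1 (B 12 L
(B 9 L (B 10 L (B 9 L (B 5 L (B 3 L (B 2 L (T 13 [::[::0;2;1;4;3;7;6;5;8]] 1 (B 12 (T 6
[::[::0;1;2;3;4;8;6;7;5]] 1 (T 16 [::[::7;1;3;2;4;5;8;0;6]] 1 (B 17 L L) L) L) L) L)))))))) (B 34
(B 7 L (T 18 [::[::0;1;2;3;4;5;6;8;7]] 1 (B 22 (T 18 [::[::0;1;2;3;4;7;6;5;8]] 1 L L) L) L)) (B 13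
L (T 21 [::[::0;1;2;3;4;5;6;8;7]] 1 (B 13 L (B 31 L (B 12 L (B 11 L (B 8 (B 22 (B 5 L L) L) (B 8 L
(B 13 (T 21 [::[::0;1;2;3;4;5;8;7;6]] 1 (B 5 L (B 4 L (B 20 L (B 19 L L)))) (T 16
[::[::0;1;2;3;4;5;8;7;6]] 1 (B 20 L (B 19 L L)) L)) (B 25 L (T 21 [::[::0;1;2;3;4;7;6;5;8]] 1 (B
23 L (B 22 L (B 21 L L))) (T 11 [::[::0;1;2;3;4;7;6;5;8]] 1 (B 20 (B 19 L L) L) L)))))))))) (B 31
L (T 11 [::[::0;1;2;3;4;5;6;8;7]] 1 L (B 9 L (B 27 (T 20 [::[::0;1;2;3;4;5;6;8;7]] 1 L (T 23
[::[::0;1;2;3;4;5;6;8;7]] 1 L L)) (B 17 (T 24 [::[::0;1;2;3;4;5;6;8;7]] 1 (B 20 L (B 18 L L)) L)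
(T 24 [::[::0;1;2;3;4;5;6;8;7]] 1 (B 24 L (B 23 L L)) L))))))))))))) (T 28
[::[::0;1;2;3;4;5;7;6;8]; [::0;1;2;3;4;5;7;8;6]; [::0;3;4;1;2;5;6;7;8]] 2 (B 19 L (T 11
[::[::0;1;2;3;4;5;6;8;7]] 1 (B 16 L (B 16 L L)) (B 39 L (B 39 L (T 37 [::[::0;1;2;3;4;5;6;8;7]] 1
L (T 15 [::[::0;1;2;3;4;5;6;8;7]] 1 L (B 9 L (T 12 [::[::0;1;2;3;4;5;6;8;7]] 1 L (T 29
[::[::0;1;2;3;4;5;6;8;7]] 1 L (T 25 [::[::0;1;2;3;4;5;6;8;7]] 1 L (B 26 L (B 25 L (B 24 L (B 23 L
(T 20 [::[::0;1;2;3;4;5;6;8;7]] 1 L L))))))))))))))) (T 17 [::[::0;1;2;3;4;5;6;8;7];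
[::0;1;2;3;4;5;8;6;7]] 1 L (T 28 [::[::0;1;2;3;4;5;7;6;8]; [::0;1;2;3;4;5;7;8;6]] 1 L (B 32 L (T 3
[::[::0;1;2;3;4;5;7;6;8]; [::0;1;2;3;4;5;7;8;6]; [::0;3;4;1;2;5;6;7;8]] 2 (B 24 L (B 29 L (B 25 L
(T 26 [::[::0;1;2;3;4;5;6;8;7]] 1 L (T 21 [::[::0;1;2;3;4;5;6;8;7]] 1 (B 15 L (B 13 L L)) (T 14
[::[::0;1;2;3;4;5;6;8;7]] 1 L L)))))) L))))))) (T 2 [::[::0;1;2;3;4;6;5;7;8];
[::0;1;2;3;4;6;7;5;8]; [::0;1;2;3;4;6;7;8;5]; [::0;2;1;3;4;5;6;7;8]; [::0;3;4;1;2;5;6;7;8]] 3 (T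
25 [::[::0;1;2;4;3;5;6;7;8]] 1 (T 27 [::[::0;1;2;3;4;5;7;6;8]; [::0;1;2;3;4;5;7;8;6]] 1 L (T 33
[::[::0;1;2;3;4;5;6;8;7]; [::0;1;2;3;4;5;8;6;7]] 1 L (B 33 L (B 28 L (B 26 L (T 16
[::[::0;1;2;3;4;5;7;6;8]; [::0;1;2;3;4;5;7;8;6]] 1 (T 21 [::[::0;1;2;3;4;5;6;8;7]] 1 (C 0) (T 16
[::[::0;1;2;3;4;5;6;8;7]] 1 (B 24 L (B 17 (C 0) (B 16 (T 13 [::[::0;1;2;3;4;5;6;8;7]] 1 (B 14 (B
13 (B 0 (B 0 (B 0 (B 0 (B 0 (B 0 (B 0 (B 0 (B 0 (B 0 (B 0 (B 0 (B 0 (B 4 L (B 3 L L)) L) L) L) L)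
L) L) L) L) L) L) L) L) L) L) L) L) L))) L)) (T 19 [::[::0;1;2;3;4;5;6;8;7];
[::0;1;2;3;4;5;8;6;7]] 1 L L))))))) (T 35 [::[::0;1;2;3;4;5;6;8;7]; [::0;1;2;3;4;5;8;6;7]] 1 (T 27
[::[::0;1;2;3;4;5;7;6;8]] 1 L (C 0)) (T 26 [::[::0;1;2;3;4;5;7;6;8]; [::0;1;2;3;4;5;7;8;6]] 1 (T
26 [::[::0;1;2;3;4;5;6;8;7]] 1 L (T 20 [::[::0;1;2;3;4;5;6;8;7]] 1 (C 0) (T 20
[::[::0;1;2;3;4;5;6;8;7]] 1 (B 23 (C 0) (C 0)) L))) (T 8 [::[::0;1;2;3;4;5;7;6;8];
[::0;1;2;3;4;5;7;8;6]; [::0;1;5;3;4;2;6;7;8]] 2 (T 29 [::[::0;1;2;3;4;5;6;8;7]] 1 (C 0) (B 29 (C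
0) (B 28 (C 0) (B 27 (C 0) (C 0))))) (T 21 [::[::0;1;5;3;4;2;6;7;8]] 1 L L))))) L))) (T 18
[::[::0;1;2;3;4;6;5;7;8]; [::0;1;2;3;4;6;7;5;8]; [::0;1;2;3;4;6;7;8;5]; [::0;1;2;3;6;4;5;7;8];
[::0;1;2;6;3;4;5;7;8]] 5 L L)) L).

Definition tree10 : cert :=
(T 0 [::[::0;1;3;2;4;5;6;7;8;9]; [::0;1;3;4;2;5;6;7;8;9]; [::0;1;3;4;5;2;6;7;8;9];
[::0;1;3;4;5;6;2;7;8;9]; [::0;1;3;4;5;6;7;2;8;9]; [::0;1;3;4;5;6;7;8;2;9];
[::0;1;3;4;5;6;7;8;9;2]; [::0;3;1;2;4;5;6;7;8;9]; [::3;0;1;2;4;5;6;7;8;9]] 5 (T 84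
[::[::0;1;2;3;4;6;5;7;8;9]; [::0;1;2;3;4;6;7;5;8;9]; [::0;1;2;3;4;6;7;8;5;9];
[::0;1;2;3;4;6;7;8;9;5]; [::0;1;2;3;6;4;5;7;8;9]; [::0;1;2;6;3;4;5;7;8;9]] 5 (T 29
[::[::0;1;2;3;4;5;6;8;7;9]; [::0;1;2;3;4;5;6;8;9;7]; [::0;1;2;3;4;5;8;6;7;9];
[::1;0;2;3;4;5;6;7;8;9]; [::1;2;0;3;4;5;6;7;8;9]; [::3;4;5;0;1;2;6;7;8;9]] 5 (T 66
[::[::0;1;2;4;3;5;6;7;8;9]; [::0;1;2;4;5;3;6;7;8;9]] 1 L (T 62 [::[::0;1;2;3;4;5;6;7;9;8];
[::0;1;2;3;5;4;6;7;8;9]; [::0;1;2;5;3;4;6;7;8;9]] 2 (T 14 [::[::0;1;2;4;3;5;6;7;8;9]] 1 L L) (T 5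
[::[::0;1;2;3;4;5;6;7;9;8]; [::0;2;1;3;4;5;6;7;8;9]; [::0;6;7;3;4;5;1;2;8;9]] 3 (B 56 L (B 54 L (T
51 [::[::0;1;2;3;4;5;7;6;8;9]; [::0;1;8;3;4;5;6;7;2;9]] 2 L (T 50 [::[::0;1;2;3;4;5;7;6;8;9]] 1 L
(T 49 [::[::0;1;8;3;4;5;6;7;2;9]] 1 L (T 33 [::[::0;1;2;3;4;5;7;6;8;9]; [::0;1;8;3;4;5;6;7;2;9]] 2
L (T 42 [::[::0;1;2;3;4;5;7;6;8;9]] 1 L (T 34 [::[::0;1;8;3;4;5;6;7;2;9]] 1 L (T 34
[::[::0;1;2;3;4;5;7;6;8;9]; [::0;1;2;4;3;5;6;7;8;9]; [::0;1;2;4;5;3;6;7;8;9]] 2 (B 33 L (B 27 L (T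
9 [::[::0;1;8;3;4;5;6;7;2;9]] 1 (C 0) (B 24 (C 0) (T 7 [::[::0;1;2;3;5;4;6;7;8;9];
[::0;1;8;3;4;5;6;7;2;9]] 2 L (T 22 [::[::0;1;2;3;5;4;6;7;8;9]] 1 L L)))))) (C 0)))))))))) (T 0
[::[::0;1;2;4;3;5;6;7;8;9]; [::0;1;2;4;5;3;6;7;8;9]; [::0;2;1;3;4;5;6;7;8;9];
[::0;6;7;3;4;5;1;2;8;9]] 3 (T 43 [::[::0;1;2;3;4;5;7;6;8;9]; [::0;1;2;3;5;4;6;7;8;9]] 2 L (T 18
[::[::0;1;2;3;4;5;6;7;9;8]; [::0;1;2;3;5;4;6;7;8;9]] 2 (B 33 L (T 29 [::[::0;1;2;3;4;5;7;6;8;9]] 1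
L (T 27 [::[::0;1;2;3;4;5;7;6;8;9]] 1 L L))) L)) L)))) (T 16 [::[::0;1;2;3;4;5;7;6;8;9];
[::0;1;2;3;4;5;7;8;6;9]; [::0;1;2;3;4;5;7;8;9;6]; [::0;1;2;4;3;5;6;7;8;9];
[::0;1;2;4;5;3;6;7;8;9]; [::1;0;2;3;4;5;6;7;8;9]; [::1;2;0;3;4;5;6;7;8;9]] 3 (T 40
[::[::0;1;2;3;4;5;6;8;7;9]; [::0;1;2;3;4;5;6;8;9;7]; [::0;1;2;3;5;4;6;7;8;9];
[::0;2;1;3;4;5;6;7;8;9]] 3 (T 23 [::[::0;1;2;3;4;5;6;7;9;8]; [::1;0;2;4;3;5;7;6;8;9];
[::3;4;5;0;1;2;6;7;8;9]] 3 L (T 56 [::[::0;1;2;3;4;5;6;7;9;8]] 1 L (T 46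
[::[::1;0;2;4;3;5;7;6;8;9]] 1 L (T 46 [::[::0;1;2;3;4;5;6;7;9;8]] 1 L (T 0
[::[::1;0;2;4;3;5;7;6;8;9]; [::3;4;5;0;1;2;6;7;8;9]] 2 (B 24 L (B 36 L (B 45 L (B 37 L (B 8 L (T
23 [::[::0;3;6;1;4;7;2;5;8;9]] 1 L (T 8 [::[::0;3;6;1;4;7;2;5;8;9]] 1 L (B 34 L (B 18 (T 23
[::[::0;1;2;3;4;5;6;7;9;8]] 1 L L) (T 24 [::[::0;1;2;3;4;5;6;7;9;8]] 1 (T 21
[::[::0;3;6;1;4;7;2;5;8;9]] 1 L L) L)))))))))) L))))) (T 21 [::[::0;1;2;3;4;5;6;8;7;9];
[::0;1;2;3;4;5;6;8;9;7]; [::0;1;2;3;5;4;6;7;8;9]; [::3;4;5;0;1;2;6;7;8;9]] 3 (T 38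
[::[::0;2;1;3;4;5;6;7;8;9]] 1 (T 14 [::[::0;1;2;3;4;5;6;7;9;8]] 1 L (B 35 L L)) (T 52
[::[::0;1;2;3;4;5;6;7;9;8]] 1 L (B 52 L (B 52 L (T 34 [::[::0;1;2;3;4;5;6;7;9;8];
[::0;2;1;3;4;5;6;7;8;9]] 2 (B 32 L (B 38 L (T 22 [::[::3;4;5;0;1;2;6;8;7;9]] 1 L L))) (B 47 L (B
46 L (T 35 [::[::0;2;1;3;4;5;6;7;8;9]] 1 (B 33 L (B 26 L (T 22 [::[::0;1;2;3;4;5;6;7;9;8]] 1 L (B
30 L (T 35 [::[::0;1;2;3;4;5;6;7;9;8]] 1 (B 25 L L) L))))) (T 32 [::[::0;2;1;3;4;5;6;7;8;9]] 1 L
(T 2 [::[::0;2;1;3;4;5;6;7;8;9]] 1 (B 35 (B 28 L L) (B 27 (T 24 [::[::0;1;2;3;4;5;6;7;9;8]] 1 (C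
0) (B 22 (C 0) L)) (T 4 [::[::0;1;2;3;4;5;6;7;9;8]] 1 (B 11 (C 0) (B 10 (C 0) (B 8 (C 0) (B 22 L
(B 8 (C 0) (B 21 L (T 6 [::[::0;1;8;3;4;5;6;7;2;9]] 1 (B 21 (C 0) (C 0)) L))))))) (T 22
[::[::0;1;2;3;4;5;6;7;9;8]] 1 (B 27 L (B 26 L (B 25 L (B 24 (C 0) (B 10 (B 23 (C 0) (C 0)) L)))))
L)))) (B 26 (T 36 [::[::0;1;2;3;4;5;6;7;9;8]] 1 L (T 23 [::[::0;1;2;3;4;5;6;7;9;8]] 1 (C 0) L)) (T
28 [::[::0;2;1;3;4;5;6;7;8;9]] 1 L (T 4 [::[::0;1;2;3;4;5;6;7;9;8]; [::0;2;1;3;4;5;6;7;8;9]] 2 (B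
10 (B 26 L (C 0)) L) L))))))))))))) (T 23 [::[::0;1;2;3;5;4;6;7;8;9]; [::3;4;5;0;1;2;6;7;8;9]] 2 L
(T 4 [::[::0;1;2;3;4;5;6;8;7;9]; [::0;1;2;3;4;5;6;8;9;7]; [::0;2;1;3;4;5;6;7;8;9];
[::3;4;5;0;1;2;6;7;8;9]] 3 L (T 1 [::[::0;1;2;3;5;4;6;7;8;9]; [::0;2;1;3;4;5;6;7;8;9];
[::3;4;5;0;1;2;6;7;8;9]] 3 L L))))) L)) (T 14 [::[::0;1;2;3;5;4;6;7;8;9]; [::0;1;2;3;5;6;4;7;8;9];
[::0;1;2;3;5;6;7;4;8;9]; [::0;1;2;3;5;6;7;8;4;9]; [::0;1;2;3;5;6;7;8;9;4];
[::0;1;2;5;3;4;6;7;8;9]; [::1;0;2;3;4;5;6;7;8;9]; [::1;2;0;3;4;5;6;7;8;9]] 4 (T 52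
[::[::0;1;2;3;4;5;7;6;8;9]; [::0;1;2;3;4;5;7;8;6;9]; [::0;1;2;3;4;5;7;8;9;6];
[::0;1;2;3;4;7;5;6;8;9]; [::0;2;1;3;4;5;6;7;8;9]] 4 (T 64 [::[::0;1;2;3;4;5;6;8;7;9];
[::0;1;2;3;4;5;6;8;9;7]; [::0;1;2;4;3;5;6;7;8;9]; [::1;0;2;5;6;3;4;7;8;9]] 3 (T 31
[::[::0;1;2;3;4;5;6;7;9;8]; [::0;1;2;3;4;6;5;7;8;9]] 2 L (T 19 [::[::0;1;2;3;4;5;6;7;9;8];
[::2;1;0;3;7;5;6;4;8;9]] 2 L L)) (T 62 [::[::0;1;2;3;4;6;5;7;8;9]; [::0;1;2;4;3;5;6;7;8;9]] 2 (T
25 [::[::0;1;2;3;4;5;6;8;7;9]; [::0;1;2;3;4;5;6;8;9;7]; [::1;0;2;5;6;3;4;7;8;9]] 2 (B 37 L (B 38 L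
(B 37 L (T 35 [::[::0;1;2;3;4;5;6;7;9;8]] 1 L (B 31 L (T 5 [::[::0;1;2;3;4;5;6;7;9;8];
[::0;2;1;6;7;5;3;4;8;9]] 2 (B 27 L (B 30 L (B 29 L (B 19 (C 0) (B 25 L (B 24 (C 0) (B 23 (B 24 L
(C 0)) L))))))) L)))))) (T 43 [::[::1;0;2;5;6;3;4;7;8;9]] 1 L (T 20 [::[::1;0;2;5;6;3;4;7;8;9]] 1
L (T 21 [::[::0;1;2;3;4;5;6;8;7;9]; [::0;1;2;3;4;5;6;8;9;7]; [::1;0;2;5;6;3;4;7;8;9]] 2 (B 29 L (T
30 [::[::0;1;2;3;4;5;6;7;9;8]] 1 L (T 12 [::[::0;1;2;3;4;5;6;7;9;8]] 1 L (T 15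
[::[::0;1;2;3;4;5;6;7;9;8]] 1 L L)))) L)))) (T 61 [::[::1;0;2;5;6;3;4;7;8;9]] 1 L (T 25
[::[::0;1;2;3;4;5;6;8;7;9]; [::0;1;2;3;4;5;6;8;9;7]; [::0;1;2;3;4;6;5;7;8;9];
[::1;0;2;5;6;3;4;7;8;9]] 3 (B 56 L (T 30 [::[::0;1;2;3;4;5;6;7;9;8]] 1 (B 13 (C 0) (B 38 L (B 37 L
(T 17 [::[::0;1;2;4;3;5;6;7;8;9]] 1 (C 0) (T 7 [::[::0;1;2;4;3;5;6;7;8;9]] 1 (C 0) (B 26 (C 0) (B
25 (C 0) (B 10 (C 0) L)))))))) (B 11 (B 29 (C 0) (T 35 [::[::0;1;2;3;4;5;6;7;9;8]] 1 L (T 16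
[::[::0;1;2;3;4;5;6;7;9;8]; [::0;1;2;4;3;5;6;7;8;9]] 2 (C 0) (T 11 [::[::0;1;2;3;4;5;6;7;9;8]] 1
(C 0) L)))) (T 14 [::[::0;1;2;4;3;5;6;7;8;9]] 1 (T 43 [::[::0;1;2;3;4;5;6;7;9;8]] 1 L (B 38 L (B
37 L (B 33 L (B 36 L (B 38 L (B 32 L (B 32 L (T 34 [::[::0;1;2;3;4;5;6;7;9;8]] 1 (C 0) (T 32
[::[::0;1;2;3;4;5;6;7;9;8]] 1 (B 27 L (C 0)) (C 0))))))))))) (B 31 (T 22
[::[::0;1;2;3;4;5;6;7;9;8]; [::0;1;2;4;3;5;6;7;8;9]] 2 (B 23 (C 1) (B 22 (C 1) (B 29 (B 25 L (C
1)) L))) L) (T 46 [::[::0;1;2;3;4;5;6;7;9;8]] 1 (T 20 [::[::0;1;2;4;3;5;6;7;8;9]] 1 (B 23 (C 1) (B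
28 (C 1) L)) L) (T 33 [::[::0;1;2;4;3;5;6;7;8;9]] 1 (T 32 [::[::0;1;2;3;4;5;6;7;9;8]] 1 L L) (B 43
L (T 11 [::[::0;1;2;3;4;5;6;7;9;8]] 1 (B 34 L (B 33 L (T 15 [::[::0;1;2;4;3;5;6;7;8;9]] 1 (C 0) (T
13 [::[::0;1;2;4;3;5;6;7;8;9]] 1 (C 0) L)))) (T 41 [::[::0;1;2;3;4;5;6;7;9;8]] 1 L (T 26
[::[::0;1;2;4;3;5;6;7;8;9]] 1 L (T 20 [::[::0;1;2;3;4;5;6;7;9;8]] 1 (T 7
[::[::0;1;2;4;3;5;6;7;8;9]] 1 (B 9 (B 0 (B 0 (B 0 (B 0 (B 0 (B 0 (B 0 (B 1 (B 1 (B 1 (B 1 (B 1 (B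
1 (B 4 (B 4 (B 4 (B 4 (B 4 (B 6 L (B 6 L (C 0))) L) L) L) L) L) L) L) L) L) L) L) L) L) L) L) L)
L) L) L) L) L)))))))))))) (T 16 [::[::0;1;2;3;4;5;6;8;7;9]; [::0;1;2;3;4;5;6;8;9;7];
[::0;1;2;4;3;5;6;7;8;9]; [::1;0;2;5;6;3;4;7;8;9]] 3 (T 40 [::[::0;1;2;3;4;5;6;7;9;8]] 1 L (B 26 (C
0) (T 12 [::[::0;1;2;3;4;5;6;7;9;8]] 1 (B 28 L (C 0)) L))) L))))) (T 42
[::[::0;1;2;3;4;6;5;7;8;9]; [::0;1;2;3;4;6;7;5;8;9]; [::0;1;2;3;4;6;7;8;5;9];
[::0;1;2;3;4;6;7;8;9;5]; [::0;1;2;4;3;5;6;7;8;9]; [::0;2;1;3;4;5;6;7;8;9]] 3 (T 28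
[::[::0;1;2;3;4;5;6;8;7;9]; [::0;1;2;3;4;5;6;8;9;7]; [::0;1;2;3;4;5;8;6;7;9]] 3 (T 45
[::[::0;1;2;3;4;5;6;7;9;8]] 1 L (T 52 [::[::0;1;2;3;4;5;7;6;8;9]] 1 L (T 49
[::[::0;1;2;3;4;5;6;7;9;8]] 1 L (B 49 L (B 45 L (B 34 L (B 44 L (B 41 L (T 22
[::[::0;1;2;3;4;5;6;7;9;8]] 1 (T 23 [::[::0;1;2;3;4;5;7;6;8;9]] 1 (C 0) (B 13 (C 0) (B 28 (C 0) (B
22 (C 0) (B 12 (C 0) (T 23 [::[::0;1;2;3;4;5;7;6;8;9]] 1 (B 27 L (C 0)) L)))))) (B 31 L (B 30 (C
0) (B 32 L (T 40 [::[::0;1;2;3;4;5;6;7;9;8]] 1 L (T 34 [::[::0;1;2;3;4;5;6;7;9;8]] 1 L (T 26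
[::[::0;1;2;3;4;5;6;7;9;8]; [::0;1;2;3;4;5;7;6;8;9]] 2 (B 30 (B 22 L (C 0)) (C 0)) (T 28
[::[::0;1;2;3;4;5;7;6;8;9]] 1 L (T 28 [::[::0;1;2;3;4;5;7;6;8;9]] 1 L (T 28
[::[::0;1;2;3;4;5;7;6;8;9]] 1 (B 26 L (C 0)) (C 0))))))))))))))))))) (T 52
[::[::0;1;2;3;4;5;7;6;8;9]; [::0;1;2;3;4;5;7;8;6;9]; [::0;1;2;3;4;5;7;8;9;6]] 1 (T 21
[::[::0;1;2;3;4;5;6;8;7;9]; [::0;1;2;3;4;5;6;8;9;7]] 1 L (B 20 L (T 11 [::[::0;1;2;3;4;5;6;8;7;9];
[::0;1;2;3;4;5;6;8;9;7]] 1 (T 25 [::[::0;1;2;3;4;5;6;7;9;8]] 1 L L) (B 10 L (T 17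
[::[::0;1;2;3;4;5;6;8;7;9]; [::0;1;2;3;4;5;6;8;9;7]] 1 L (T 12 [::[::0;1;2;3;4;5;6;8;7;9];
[::0;1;2;3;4;5;6;8;9;7]] 1 L (B 10 L (B 11 L (B 11 L (B 10 L (T 30 [::[::0;1;2;3;4;5;6;8;7;9];
[::0;1;2;3;4;5;6;8;9;7]] 1 (T 27 [::[::0;1;2;3;4;5;6;7;9;8]] 1 L (B 3 L L)) L))))))))))) (T 10
[::[::0;1;2;3;4;5;7;6;8;9]; [::0;1;2;3;4;5;7;8;6;9]; [::0;1;2;3;4;5;7;8;9;6]] 1 (T 41
[::[::0;1;2;3;4;5;6;8;7;9]; [::0;1;2;3;4;5;6;8;9;7]] 1 L (T 31 [::[::0;1;2;3;4;5;6;8;7;9];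
[::0;1;2;3;4;5;6;8;9;7]] 1 (B 19 L (T 21 [::[::0;1;2;3;4;5;6;7;9;8]] 1 L (B 19 L (T 18
[::[::1;0;2;3;5;4;7;6;8;9]] 1 L (T 9 [::[::1;0;2;3;5;4;7;6;8;9]] 1 (B 25 L (B 24 L (B 19 (B 12 L
(B 12 L (B 0 (B 2 (B 15 L L) (B 2 L L)) (B 0 (B 0 L L) L)))) (T 27 [::[::0;1;2;3;4;5;6;7;9;8]] 1
(B 1 L (B 1 L L)) L)))) (T 33 [::[::0;1;2;3;4;5;6;7;9;8]] 1 (T 31 [::[::1;0;2;3;5;4;7;6;8;9]] 1 L
L) L)))))) (B 36 L (T 40 [::[::0;1;2;3;4;5;6;8;7;9]; [::0;1;2;3;4;5;6;8;9;7]] 1 (B 33 L (T 22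
[::[::0;1;2;3;4;5;6;7;9;8]] 1 (B 1 L L) (B 18 L (B 19 L (B 34 L (B 18 L (T 5
[::[::0;1;2;3;4;5;6;7;9;8]] 1 L (T 29 [::[::0;1;2;3;4;5;6;7;9;8]] 1 (B 7 L L) L)))))))) (T 24
[::[::0;1;2;3;4;5;6;8;7;9]; [::0;1;2;3;4;5;6;8;9;7]] 1 (B 35 L (B 29 L (B 30 L (B 29 L (B 29 L (T
21 [::[::0;1;2;3;4;5;6;7;9;8]] 1 (C 0) (B 20 (C 0) (B 19 (C 0) (B 25 L (B 23 L (T 16
[::[::0;1;2;3;4;5;6;7;9;8]] 1 (B 24 L (C 0)) L))))))))))) (B 26 L (B 28 L (B 27 L (T 15
[::[::0;1;2;3;4;5;6;8;7;9]; [::0;1;2;3;4;5;6;8;9;7]] 1 (T 27 [::[::0;1;2;3;4;5;6;7;9;8]] 1 L (B 31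
L (T 20 [::[::0;1;2;3;4;5;6;7;9;8]] 1 (B 23 L (C 0)) L))) L))))))))) (T 37
[::[::0;1;2;3;4;5;7;6;8;9]; [::0;1;2;3;4;5;7;8;6;9]; [::0;1;2;3;4;5;7;8;9;6]] 1 (T 12
[::[::0;1;2;3;4;5;6;8;7;9]; [::0;1;2;3;4;5;6;8;9;7]] 1 (T 21 [::[::0;1;2;3;4;5;6;7;9;8]] 1 L (B 19
L (T 17 [::[::0;1;2;3;4;5;6;7;9;8]] 1 L L))) (T 40 [::[::0;1;2;3;4;5;6;8;7;9];
[::0;1;2;3;4;5;6;8;9;7]] 1 (T 23 [::[::0;1;2;3;4;5;6;7;9;8]] 1 (B 9 L L) L) (T 18
[::[::0;1;2;3;4;5;6;8;7;9]; [::0;1;2;3;4;5;6;8;9;7]] 1 L (T 31 [::[::0;1;2;3;4;5;6;8;7;9];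
[::0;1;2;3;4;5;6;8;9;7]] 1 (B 9 L (T 14 [::[::0;1;2;3;4;5;6;7;9;8]] 1 L (B 9 L (B 12 L (B 9 L (B
11 L (B 10 L (B 27 L (B 26 (T 5 [::[::0;1;2;3;4;5;6;7;9;8]] 1 (C 1) L) (B 9 L (T 19
[::[::0;1;2;3;4;5;6;7;9;8]] 1 (B 24 L (C 1)) L))))))))))) (T 14 [::[::0;1;2;3;4;5;6;8;7;9];
[::0;1;2;3;4;5;6;8;9;7]] 1 L (B 13 L (B 10 L (B 27 L (B 12 L (T 21 [::[::0;1;2;3;4;5;6;8;7;9];
[::0;1;2;3;4;5;6;8;9;7]] 1 (B 8 L L) L)))))))))) (T 20 [::[::0;1;2;3;4;5;7;6;8;9];
[::0;1;2;3;4;5;7;8;6;9]; [::0;1;2;3;4;5;7;8;9;6]] 1 (T 39 [::[::0;1;2;3;4;5;6;8;7;9];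
[::0;1;2;3;4;5;6;8;9;7]] 1 L (T 27 [::[::0;1;2;3;4;5;6;8;7;9]; [::0;1;2;3;4;5;6;8;9;7]] 1 L (B 23
L (B 32 L (T 28 [::[::0;1;2;3;4;5;6;8;7;9]; [::0;1;2;3;4;5;6;8;9;7]] 1 L (B 23 L (B 26 L (T 20
[::[::0;1;2;3;4;5;6;8;7;9]; [::0;1;2;3;4;5;6;8;9;7]] 1 (T 5 [::[::0;1;2;3;4;5;6;7;9;8]] 1 (B 18 (C
0) L) L) L)))))))) (T 16 [::[::0;1;2;3;4;5;7;6;8;9]; [::0;1;2;3;4;5;7;8;6;9];
[::0;1;2;3;4;5;7;8;9;6]] 1 L (T 19 [::[::0;1;2;3;4;5;7;6;8;9]; [::0;1;2;3;4;5;7;8;6;9];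
[::0;1;2;3;4;5;7;8;9;6]] 1 (B 15 L (T 18 [::[::0;1;2;3;4;5;6;8;7;9]; [::0;1;2;3;4;5;6;8;9;7]] 1 (T
21 [::[::0;1;2;3;4;5;6;7;9;8]] 1 (B 29 L (T 25 [::[::0;1;2;3;4;5;7;6;8;9]] 1 (B 22 L (B 1 L L))
L)) (T 19 [::[::0;1;2;3;4;5;7;6;8;9]] 1 (B 27 L L) L)) (T 20 [::[::0;1;2;3;4;5;6;8;7;9];
[::0;1;2;3;4;5;6;8;9;7]] 1 (B 10 (T 12 [::[::0;1;2;3;4;5;6;7;9;8]] 1 (B 0 (B 0 (B 0 L L) L) L) L)
L) L))) (T 11 [::[::0;1;2;3;4;5;7;6;8;9]; [::0;1;2;3;4;5;7;8;6;9]; [::0;1;2;3;4;5;7;8;9;6];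
[::1;0;2;3;5;4;6;7;8;9]] 2 (B 30 L (B 23 L (T 20 [::[::0;1;2;3;4;5;6;8;7;9];
[::0;1;2;3;4;5;6;8;9;7]] 1 (T 26 [::[::0;1;2;3;4;5;6;7;9;8]] 1 (B 6 L L) L) L))) L)))))))) (T 36
[::[::0;1;2;3;4;6;5;7;8;9]; [::0;1;2;3;4;6;7;5;8;9]; [::0;1;2;3;4;6;7;8;5;9];
[::0;1;2;3;4;6;7;8;9;5]] 1 (T 28 [::[::0;1;2;3;4;5;6;8;7;9]; [::0;1;2;3;4;5;6;8;9;7];
[::0;1;2;3;4;5;8;6;7;9]] 3 (C 0) (T 15 [::[::0;1;2;3;4;5;7;6;8;9]; [::0;1;2;3;4;5;7;8;6;9];
[::0;1;2;3;4;5;7;8;9;6]; [::0;1;2;4;3;5;6;7;8;9]] 2 (T 28 [::[::0;1;2;3;4;5;6;8;7;9];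
[::0;1;2;3;4;5;6;8;9;7]] 1 L (C 0)) L)) (C 0)))) L)) L).

End Trees.

(** * The four extremal facts and the bounds that they yield *)

Lemma turan7 : turan 7 24 6.
Proof. by apply: (@turan_of_check _ _ _ tree7); vm_compute. Qed.

Lemma turan8 : turan 8 25 4.
Proof. by apply: (@turan_of_check _ _ _ tree8); vm_compute. Qed.

Lemma turan9 : turan 9 27 3.
Proof. by apply: (@turan_of_check _ _ _ tree9); vm_compute. Qed.

Lemma turan10 : turan 10 30 4.
Proof. by apply: (@turan_of_check _ _ _ tree10); vm_compute. Qed.

Lemma uncoloured_gt_0 m : m < 20 -> uncoloured_gt 0 6 m.
Proof. by move=> lt_m col cs /size0nil -> _; rewrite count_predT. Qed.

Lemma uncoloured_gt_le r n m m' :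
  m <= m' -> uncoloured_gt r n m' -> uncoloured_gt r n m.
Proof. by move=> le_m few col cs rcs free; apply: leq_ltn_trans le_m (few _ _ rcs free). Qed.

(** There are 35 triples on 7 vertices: 11 + 23 < 35, and 11 + 6 = 17 is still below 20. *)
Lemma uncoloured_gt_1 : uncoloured_gt 1 7 11.
Proof. exact: (uncoloured_gt_step turan7 _ (uncoloured_gt_0 _)). Qed.

(** There are 56 triples on 8 vertices: 7 + 2 * 24 < 56, and 7 + 4 = 11. *)
Lemma uncoloured_gt_2 : uncoloured_gt 2 8 7.
Proof. by apply: (uncoloured_gt_step turan8) => //; apply: uncoloured_gt_1. Qed.

(** There are 84 triples on 9 vertices: 4 + 3 * 26 < 84, and 4 + 3 = 7. *)
Lemma uncoloured_gt_3 : uncoloured_gt 3 9 4.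
Proof. by apply: (uncoloured_gt_step turan9) => //; apply: uncoloured_gt_2. Qed.

(** There are 120 triples on 10 vertices: 4 * 29 < 120, and 0 + 4 = 4. *)
Lemma uncoloured_gt_4 : uncoloured_gt 4 10 0.
Proof. by apply: (uncoloured_gt_step turan10) => //; apply: uncoloured_gt_3. Qed.

(** * From bit sequences to 3-graphs: the upper bound *)

Definition set_p4 (T : finType) (a b c d : {set T}) : bool :=
  [&& a :&: b != set0, b :&: c != set0, c :&: d != set0,
      a :&: c == set0, a :&: d == set0 & b :&: d == set0].

(** Nonemptiness settles the four cases [i = j]; the six conditions of [set_p4] settle the other
    twelve by symmetry of the intersection. *)
Lemma set_p4_dist (T : finType) (A : 'I_4 -> {set T}) (a b c d : {set T}) :
  A =1 (fun i : 'I_4 => nth set0 [:: a; b; c; d] i) -> a != set0 -> b != set0 ->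
  c != set0 -> d != set0 -> set_p4 a b c d ->
  forall i j : 'I_4, A i :&: A j <> set0 <-> (`|i - j| <= 1)%N.
Proof.
move=> eqA a0 b0 c0 d0 /and5P[ab bc cd ac /andP[ad bd]] i j; rewrite !eqA.
case: i j => [[|[|[|[|//]]]] ?] [[|[|[|[|//]]]] ?] /=; rewrite ?setIid;
  do ?[by split=> // _; apply/eqP | by split=> // _; rewrite setIC; apply/eqP
      | by split=> // neq; case: neq; apply/eqP
      | by split=> // neq; case: neq; rewrite setIC; apply/eqP].
Qed.

Lemma card3_neq0 (T : finType) (e : {set T}) : #|e| = 3 -> e != set0.
Proof. by move=> e3; rewrite -card_gt0 e3. Qed.

(** Isolated vertices are forbidden, so the path is built on the union [U] of the four edges as its
    vertex type, and [val] embeds it. *)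
Lemma minimal_4path_copy (G : graph3) (a b c d : {set vertex G}) :
  a \in edges G -> b \in edges G -> c \in edges G -> d \in edges G ->
  set_p4 a b c d -> exists2 F, minimal_4path F & contains_copy F G.
Proof.
move=> Ga Gb Gc Gd abcd.
pose A (i : 'I_4) := nth set0 [:: a; b; c; d] i.
pose U := \bigcup_i A i.
pose T : finType := {x : vertex G | x \in U}.
pose pre (s : {set vertex G}) : {set T} := [set x | val x \in s].
have GA i : A i \in edges G by case: i => [[|[|[|[|]]]]].
have sAU i : A i \subset U by apply: bigcup_sup.
have preK i : val @: pre (A i) = A i.
  apply/setP => x; apply/imsetP/idP => [[y + ->]|Ax]; first by rewrite inE.
  by exists (Sub x (subsetP (sAU i) x Ax)); rewrite ?inE.
have pre0 (s t : {set vertex G}) : (s \subset U) -> (pre s :&: pre t == set0) = (s :&: t == set0).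
  move=> /subsetP sU; apply/eqP/eqP => /setP st0; apply/setP => x.
    rewrite !inE; apply/negP => /andP[sx tx].
    by have := st0 (Sub x (sU x sx)); rewrite !inE /= sx tx.
  by have := st0 (val x); rewrite !inE.
have F3 e : e \in [set pre (A i) | i : 'I_4] -> #|e| = 3.
  case/imsetP => i _ ->; rewrite -(card_imset _ val_inj) preK.
  exact: edges_card3 (GA i).
exists (Graph3 F3); last first.
  by exists val => [|_ /imsetP[i _ ->]]; [apply: val_inj | rewrite preK].
split=> [x|].
  have /bigcupP[i _ Aix] := valP x.
  by exists (pre (A i)); rewrite ?inE //; apply: imset_f.
exists (fun i => pre (A i)); split=> //.
have A3 i : #|pre (A i)| = 3 by apply: F3; apply: imset_f.
have sU (i : nat) : i < 4 -> nth set0 [:: a; b; c; d] i \subset U.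
  by move=> lt_i4; apply: (sAU (Ordinal lt_i4)).
(* [pre0] asks for inclusion of the first set of an intersection, and [d] only ever comes second. *)
have [aU bU cU] : [/\ a \subset U, b \subset U & c \subset U].
  by split; [apply: (sU 0) | apply: (sU 1) | apply: (sU 2)].
have pre_abcd: set_p4 (pre a) (pre b) (pre c) (pre d).
  by move: abcd; rewrite /set_p4 !pre0.
apply: set_p4_dist pre_abcd; first by case=> [[|[|[|[|]]]]].
- exact: card3_neq0 (A3 (@Ordinal 4 0 isT)).
- exact: card3_neq0 (A3 (@Ordinal 4 1 isT)).
- exact: card3_neq0 (A3 (@Ordinal 4 2 isT)).
- exact: card3_neq0 (A3 (@Ordinal 4 3 isT)).
Qed.

Section SetOf.
Variable n : nat.

Definition set_of (e : bitseq) : {set 'I_n} := [set i : 'I_n | nth false e i].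

Lemma card_set_of e : size e = n -> #|set_of e| = count id e.
Proof.
move=> size_e; rewrite cardsE cardE size_filter -enumT.
rewrite -(count_map (@nat_of_ord n) (nth false e)) val_enum_ord.
by rewrite -{2}(mkseq_nth false e) size_e count_map.
Qed.

Lemma meet_set_of e f : size e = n -> meet e f = (set_of e :&: set_of f != set0).
Proof.
move=> size_e; apply/meetP/set0Pn => [[i ei fi]|[i]]; last first.
  by rewrite !inE => /andP[ei fi]; exists i.
have lt_in: i < n.
  by rewrite -size_e ltnNge; apply/negP => le_i; rewrite nth_default in ei.
by exists (Ordinal lt_in); rewrite !inE /= ei.
Qed.

End SetOf.

(** Without a monochromatic minimal 4-path all classes of [c] would satisfy [p4free], so some triple
    would have a colour outside [iota 0 r]; but [c] colours every triple. *)
Lemma arrows_of_uncoloured_gt r n :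
  uncoloured_gt r n 0 -> arrows minimal_4path r n.
Proof.
move=> few c.
(* The default [r] lies outside [iota 0 r]: bit sequences that are not edges count as uncoloured. *)
pose col e := if insub (set_of n e) is Some s then nat_of_ord (c s) else r.
(* A boolean search over finitely many quadruples, so that arguing by contradiction is
   constructive. *)
pose mono := [exists i : 'I_r, [exists x : {set 'I_n}, [exists y : {set 'I_n},
  [exists z : {set 'I_n}, [exists w : {set 'I_n},
    [&& x \in edges (color_class c i), y \in edges (color_class c i),
        z \in edges (color_class c i), w \in edges (color_class c i)
      & set_p4 x y z w]]]]]].
suff: mono.
  case/existsP => i /existsP[x] /existsP[y] /existsP[z] /existsP[w].
  case/and5P => Gx Gy Gz Gw xyzw; exists i.
  exact: (@minimal_4path_copy (color_class c i) _ _ _ _ Gx Gy Gz Gw xyzw).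
have edgeE e : e \in triples n 3 -> set_of n e \in edges (complete3 n).
  rewrite mem_triples => /andP[/eqP size_e /eqP e3].
  by rewrite inE card_set_of ?e3.
apply: contraT => no_mono.
have: 0 < count (fun e => col e \notin iota 0 r) (triples n 3).
  apply: few; first by rewrite size_iota.
  move=> i; rewrite mem_iota => /andP[_ lt_ir] x y z w Gx Gy Gz Gw.
  have class e : colour_class n col i e ->
      set_of n e \in edges (color_class c (Ordinal lt_ir)).
    case/andP => /edgeE Ee; rewrite /col insubT => /eqP ce.
    by apply/imsetP; exists (Sub (set_of n e) Ee); rewrite ?inE //; apply/eqP/val_inj.
  apply: contra no_mono => xyzw.
  apply/existsP; exists (Ordinal lt_ir).
  apply/existsP; exists (set_of n x); apply/existsP; exists (set_of n y).
  apply/existsP; exists (set_of n z); apply/existsP; exists (set_of n w).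
  rewrite (class x Gx) (class y Gy) (class z Gz) (class w Gw) /=.
  have size_n e : colour_class n col i e -> size e = n.
    by case/andP; rewrite mem_triples => /andP[/eqP].
  by move: xyzw; rewrite /p4 /set_p4 !(@meet_set_of n) ?size_n // !negbK.
rewrite -has_count => /hasP[e /edgeE Ee]; rewrite mem_iota /= /col insubT.
by rewrite ltn_ord.
Qed.

(** * The lower bound *)

Lemma set_p4_of_minimal_4path (F : graph3) : minimal_4path F ->
  exists a b c d, [/\ a \in edges F, b \in edges F, c \in edges F, d \in edges F
    & set_p4 a b c d].
Proof.
case=> _ [A [eF distA]].
pose o i (lt_i : i < 4) := Ordinal lt_i.
exists (A (@o 0 isT)), (A (@o 1 isT)), (A (@o 2 isT)), (A (@o 3 isT)).
have FA i : A i \in edges F by rewrite eF imset_f.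
have far (i j : 'I_4) : ~~ (`|i - j| <= 1)%N -> A i :&: A j == set0.
  by move=> ij; apply/eqP; apply: contraNeq ij => /eqP /distA.
split=> //; rewrite /set_p4; apply/and5P; split; try exact: far; try (apply/eqP/distA=> //).
by rewrite !far.
Qed.

Lemma set_p4_imset (T T' : finType) (f : T -> T') (a b c d : {set T}) :
  injective f -> set_p4 (f @: a) (f @: b) (f @: c) (f @: d) = set_p4 a b c d.
Proof. by move=> f_inj; rewrite /set_p4 -!imsetI ?imset_eq0 //; apply: in2W. Qed.

(** Both [c] and [d] are disjoint from [a]. Within six vertices both would be the complement of [a],
    hence equal, but [b] meets [c] and not [d]. *)
Lemma set_p4_card_gt6 (T : finType) (a b c d U : {set T}) :
  #|a| = 3 -> #|c| = 3 -> #|d| = 3 -> a \subset U -> c \subset U -> d \subset U ->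
  set_p4 a b c d -> 6 < #|U|.
Proof.
move=> a3 c3 d3 aU cU dU /and5P[_ bc _ ac /andP[ad /eqP bd]].
rewrite ltnNge; apply: contra bc => U6.
have rest (e : {set T}) : #|e| = 3 -> e \subset U -> a :&: e == set0 -> e = U :\: a.
  move=> e3 eU ae; apply/eqP; rewrite eqEcard e3 cardsD (setIidPr aU) a3.
  by rewrite subsetD eU -setI_eq0 setIC ae /= leq_subLR.
by rewrite (rest c) // -(rest d) // bd.
Qed.

Lemma arrows_lower_bound r m : 0 < r -> arrows minimal_4path r m -> r + 6 <= m.
Proof.
case: r => // r _ arr; rewrite leqNgt addSn ltnS; apply/negP => le_m.
pose low (e : {set 'I_m}) v := [exists x : 'I_m, (x \in e) && (val x == v)].
(* After the case split there are [r.+1] colours. [find] gives the least element of the triple if it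
   is below [r]; otherwise it gives [r], the colour of the triples among the last vertices. *)
pose c (e : edge_of (complete3 m)) : 'I_r.+1 := inord (find (low (val e)) (iota 0 r)).
have [i [F /set_p4_of_minimal_4path[x [y [z [w [Fx Fy Fz Fw xyzw]]]]]]] := arr c.
case=> f f_inj copy; rewrite -(set_p4_imset _ _ _ _ f_inj) in xyzw.
have classP (e : {set vertex F}) : e \in edges F -> #|f @: e| = 3 /\ find (low (f @: e)) (iota 0 r) = i.
  move=> /copy Ge; split; first exact: edges_card3 Ge.
  case/imsetP: Ge => s; rewrite inE => /eqP <- ->.
  by rewrite /c inordK // ltnS -[X in _ <= X](size_iota 0 r) find_size.
have [x3 fx] := classP x Fx; have [z3 fz] := classP z Fz; have [w3 fw] := classP w Fw.
have [lt_ir|le_ri] := ltnP i r.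
  have inP (e : {set vertex F}) : find (low (f @: e)) (iota 0 r) = i ->
      forall lt_im : i < m, Ordinal lt_im \in f @: e.
    move=> fe lt_im; have: has (low (f @: e)) (iota 0 r).
      by rewrite has_find fe size_iota.
    move/(nth_find 0); rewrite fe nth_iota // => /existsP[v /andP[ve /eqP vi]].
    by rewrite (_ : Ordinal lt_im = v) //; apply: val_inj; rewrite /= vi.
  (* The vertex [i] exists because the edge [f @: x] of colour [i] contains it. *)
  have lt_im : i < m.
    have: has (low (f @: x)) (iota 0 r) by rewrite has_find fx size_iota.
    move/(nth_find 0); rewrite fx nth_iota // => /existsP[v /andP[_ /eqP vi]].
    by rewrite -[nat_of_ord i]add0n -vi ltn_ord.
  (* All edges of colour [i] contain the vertex [i], but the first and the third edge of the path
     are disjoint. *)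
  case/and5P: xyzw => _ _ _ /eqP /setP /(_ (Ordinal lt_im)).
  by rewrite !inE !inP.
(* The last colour lives on the vertices from [r] on, of which there are at most six since
   [m <= r + 6]. *)
pose U := [set v : 'I_m | r <= v].
have inU (e : {set vertex F}) : find (low (f @: e)) (iota 0 r) = i -> f @: e \subset U.
  move=> fe; apply/subsetP => v ve; rewrite inE leqNgt; apply/negP => lt_vr.
  have: ~~ has (low (f @: e)) (iota 0 r) by rewrite has_find fe size_iota -leqNgt.
  move/hasPn/(_ (val v)); rewrite mem_iota lt_vr => /(_ isT)/existsP[].
  by exists v; rewrite ve eqxx.
have := set_p4_card_gt6 x3 z3 w3 (inU x fx) (inU z fz) (inU w fw) xyzw.
rewrite ltnNge; suff ->: #|U| <= 6 by [].
rewrite cardsE cardE size_filter -enumT.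
rewrite -(count_map (@nat_of_ord m) (leq r)) val_enum_ord -size_filter.
have sub: {subset [seq v <- iota 0 m | r <= v] <= iota r 6}.
  by move=> v; rewrite mem_filter !mem_iota; lia.
by have := uniq_leq_size (filter_uniq _ (iota_uniq 0 m)) sub.
Qed.

Theorem theorem1p2 (r : nat) (hr : 1 <= r <= 4) :
  is_ramsey_number minimal_4path r (r + 6).
Proof.
split=> [|m]; last by apply: arrows_lower_bound; case/andP: hr.
apply: arrows_of_uncoloured_gt.
case: r hr => [|[|[|[|[|r]]]]] //= _.
- exact: uncoloured_gt_le uncoloured_gt_1.
- exact: uncoloured_gt_le uncoloured_gt_2.
- exact: uncoloured_gt_le uncoloured_gt_3.
- exact: uncoloured_gt_4.
Qed.
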